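(* Let $\mathcal{H}$ be a real Hilbert space with $3\le\dim(\mathcal{H})\le\infty$. Let $A_1,A_2$ be bounded selfadjoint linear operators on $\mathcal{H}$, $a_1,a_2\in\mathcal{H}$ and $b_1,b_2\in\mathbb{R}$. For $j=1,2$ define $\phi_j:\mathcal{H}\to\mathbb{R}$ by $\phi_j(x)=\langle A_jx,x\rangle+\langle x,a_j\rangle+b_j$, and let $\Phi=(\phi_1,\phi_2):\mathcal{H}\to\mathbb{R}^2$. Suppose that there are real numbers $\alpha_1,\alpha_2,\beta_1,\beta_2$ with $\alpha_1\beta_2-\alpha_2\beta_1\neq 0$ such that the linear combinations $$\tilde A_1:=\alpha_1A_1+\alpha_2A_2,\qquad \tilde A_2:=\beta_1A_1+\beta_2A_2$$ satisfy: $\tilde A_1$ is compact, $\langle\tilde A_1x,x\rangle=0$ for some $x\neq 0$ in $\mathcal{H}$, and $\tilde A_2\in GL(\mathcal{H})^+$. Then $\Phi(\mathcal{H})$ is a convex and closed subset of $\mathbb{R}^2$.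
   Context: $GL(\mathcal{H})^+$ denotes the set of bounded linear operators $T$ on $\mathcal{H}$ that are invertible (with bounded inverse) and positive definite, i.e. $T$ is symmetric ($\langle Tx,y\rangle=\langle x,Ty\rangle$ for all $x,y$) and $\langle Tx,x\rangle>0$ for all $x\neq 0$. The condition $3\le\dim(\mathcal{H})\le\infty$ means that $\mathcal{H}$ has dimension at least $3$, possibly infinite. *)

(* Defs.v *)
From HB Require Import structures.
From mathcomp Require Import all_boot all_order all_algebra sesquilinear.
From mathcomp Require Import all_classical all_reals all_analysis.

Set Implicit Arguments.
Unset Strict Implicit.
Unset Printing Implicit Defensive.

Import Order.TTheory GRing.Theory Num.Theory.
Import numFieldNormedType.Exports.

Local Open Scope classical_set_scope.
Local Open Scope ring_scope.

(* A real Hilbert space is a complete normed module [H] over a [realType]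
   together with a symmetric, bilinear, positive definite form
   [ip : {dot H for idfun}] that induces the norm of [H]. *)
Definition induces_norm (R : realType) (H : completeNormedModType R)
    (ip : {dot H for idfun}) : Prop :=
  forall x : H, `|x| ^+ 2 = ip x x.

(* The dimension of [H] as a vector space, finite or infinite, is at least
   [n].  ([\dim] is only available for finite-dimensional spaces.) *)
Definition dim_at_least (R : realType) (H : lmodType R) (n : nat) : Prop :=
  exists e : 'I_n -> H,
    forall c : 'I_n -> R, \sum_(i < n) c i *: e i = 0 -> forall i, c i = 0.

Definition bounded_operator (R : realType) (H : normedModType R)
    (T : H -> H) : Prop :=
  linear T /\ exists M : R, forall x : H, `|T x| <= M * `|x|.

Definition compact_operator (R : realType) (H : normedModType R)
    (T : H -> H) : Prop :=
  linear T /\ forall B : set H, bounded_set B -> precompact (T @` B).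

(* For everywhere defined bounded operators this is selfadjointness. *)
Definition symmetric_operator (R : realType) (H : lmodType R)
    (ip : {dot H for idfun}) (T : H -> H) : Prop :=
  forall x y : H, ip (T x) y = ip x (T y).

Definition GL_plus (R : realType) (H : normedModType R)
    (ip : {dot H for idfun}) : set (H -> H) :=
  [set T | [/\ bounded_operator T,
               exists S : H -> H,
                 [/\ bounded_operator S, cancel T S & cancel S T],
               symmetric_operator ip T &
               forall x : H, x != 0 -> 0 < ip (T x) x]].

Definition quadratic_function (R : realType) (H : lmodType R)
    (ip : {dot H for idfun}) (A : H -> H) (a : H) (b : R) (x : H) : R :=
  ip (A x) x + ip x a + b.

(* Main.v *)
(* An invertible linear change of coordinates in the plane and a translation
   in [H] (completing the square with the inverse of [tA2]) reduce [Phi] to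
   the pair [(f, g)] with [g x = <B x, x>], [B] coercive, and
   [f x = <A x, x> + <x, a>], [A] compact.  A weak limit, obtained as a limit
   along an ultrafilter, preserves [f] and can only lower [g]; moving along an
   isotropic vector of [A] brings [g] back to its value without lowering [f]
   (or without raising it), and since the sphere [g = s] is connected [f] can
   be kept fixed.  Hence the image is closed, and [f] attains its extrema on
   every sphere.  At an extremum there is a Lagrange multiplier [mu] with
   [f w <= f z + mu (g w - s)] for all [w]; this bounds convex combinations of
   values of [f] by its extrema on the sphere of the averaged level, and
   connectedness of that sphere yields convexity. *)

Require Import Defs.
From HB Require Import structures.
From mathcomp Require Import all_boot all_order all_algebra sesquilinear.
From mathcomp Require Import all_classical all_reals all_analysis.
From mathcomp Require Import ring lra.

Set Implicit Arguments.
Unset Strict Implicit.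
Unset Printing Implicit Defensive.

Import Order.TTheory GRing.Theory Num.Theory.
Import numFieldNormedType.Exports.

Local Open Scope classical_set_scope.
Local Open Scope ring_scope.

(** * Symmetric forms and quadratic functions along a line *)

Definition symmetric_form (R : realType) (V : lmodType R) (b : V -> V -> R) :=
  [/\ forall x y z, b (x + y) z = b x z + b y z,
      forall c x y, b (c *: x) y = c * b x y &
      forall x y, b x y = b y x].

Definition definite_form (R : realType) (V : lmodType R) (b : V -> V -> R) :=
  symmetric_form b /\ forall x, x != 0 -> 0 < b x x.

(** Taking a bare form and a functional keeps topology on [V] out of the argument, and negating both
    [q] and [l] turns minima into maxima. *)
Definition quadratic (R : realType) (V : lmodType R) (q : V -> V -> R)
    (l : V -> R) (x : V) : R := q x x + l x.

Lemma symmetric_form_line (R : realType) (V : lmodType R) (b : V -> V -> R)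
    (x h : V) (t : R) : symmetric_form b ->
  b (x + t *: h) (x + t *: h) = b x x + t * (b x h *+ 2) + t ^+ 2 * b h h.
Proof.
move=> [bD bZ bC].
rewrite !bD !bZ [b x (_ + _)]bC [b h (_ + _)]bC !bD !bZ (bC h x) //.
ring.
Qed.

Lemma quadratic_line (R : realType) (V : lmodType R) (q : V -> V -> R)
    (l : V -> R) (x h : V) (t : R) : symmetric_form q -> scalar l ->
  quadratic q l (x + t *: h) =
  quadratic q l x + t * (q x h *+ 2 + l h) + t ^+ 2 * q h h.
Proof.
move=> sq ll; rewrite /quadratic symmetric_form_line // addrC [x + _]addrC ll.
ring.
Qed.

Lemma symmetric_form0 (R : realType) (V : lmodType R) (b : V -> V -> R)
    (y : V) : symmetric_form b -> b 0 y = 0.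
Proof. by move=> [_ bZ _]; rewrite -(scale0r 0) bZ mul0r. Qed.

Lemma symmetric_formDr (R : realType) (V : lmodType R) (b : V -> V -> R)
    (x y z : V) : symmetric_form b -> b z (x + y) = b z x + b z y.
Proof. by move=> [bD _ bC]; rewrite bC bD !(bC z). Qed.

Lemma symmetric_formZr (R : realType) (V : lmodType R) (b : V -> V -> R)
    (c : R) (x z : V) : symmetric_form b -> b z (c *: x) = c * b z x.
Proof. by move=> [_ bZ bC]; rewrite bC bZ !(bC z). Qed.

Lemma definite_form_ge0 (R : realType) (V : lmodType R) (b : V -> V -> R)
    (x : V) : definite_form b -> 0 <= b x x.
Proof.
move=> [sb b_gt0]; have [->|/b_gt0/ltW//] := eqVneq x 0.
by rewrite symmetric_form0.
Qed.

Lemma definite_form_CauchySchwarz (R : realType) (V : lmodType R)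
    (b : V -> V -> R) (x y : V) : definite_form b ->
  b x y ^+ 2 <= b x x * b y y.
Proof.
move=> db; have [sb b_gt0] := db; have [bD bZ bC] := sb.
have [->|/b_gt0 y_gt0] := eqVneq y 0.
  by rewrite bC !symmetric_form0 // expr0n mulr0.
(* The form at this vector is [b y y] times the Gram determinant of [x] and [y]. *)
have := definite_form_ge0 (b y y *: x + (- b x y) *: y) db.
rewrite symmetric_form_line // symmetric_formZr // !bZ => h.
rewrite -subr_ge0 -(pmulr_rge0 _ y_gt0).
suff -> : b y y * (b x x * b y y - b x y ^+ 2) =
  b y y * (b y y * b x x) + - b x y * ((b y y * b x y) *+ 2)
     + (- b x y) ^+ 2 * b y y by [].
ring.
Qed.

(** * Moving to and along the level spheres of a definite form *)

(* The polynomial [s + 2 t d + a t^2] with [s <= 0 < a] has roots of both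
   signs. *)
Lemma quadratic_equation_root (R : realType) (a d s L : R) :
  0 < a -> s <= 0 ->
  exists t, s + t * (d *+ 2) + t ^+ 2 * a = 0 /\ 0 <= t * L.
Proof.
move=> a0 s0; pose D := d ^+ 2 - a * s.
have D0 : 0 <= D by rewrite /D; nra.
pose r := Num.sqrt D.
have rr : r ^+ 2 = D by rewrite sqr_sqrtr.
have r0 : 0 <= r by exact: sqrtr_ge0.
have dr : d ^+ 2 <= r ^+ 2 by rewrite rr /D; nra.
have an0 : a != 0 by rewrite gt_eqF.
(* As [r] is at least [|d|], the root [(r - d) / a] is nonnegative and [(- r - d) / a] nonpositive;
   the sign of [L] selects one. *)
have [L0|L0] := leP 0 L.
- exists ((r - d) / a); split.
    apply: (mulfI an0); rewrite mulr0.
    have -> : a * (s + (r - d) / a * (d *+ 2) + ((r - d) / a) ^+ 2 * a) =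
      a * s + r ^+ 2 - d ^+ 2 by field.
    by rewrite rr /D; ring.
  apply: mulr_ge0 => //; apply: divr_ge0; last exact: ltW.
  by nra.
- exists ((- r - d) / a); split.
    apply: (mulfI an0); rewrite mulr0.
    have -> : a * (s + (- r - d) / a * (d *+ 2) + ((- r - d) / a) ^+ 2 * a) =
      a * s + r ^+ 2 - d ^+ 2 by field.
    by rewrite rr /D; ring.
  rewrite -mulrNN; apply: mulr_ge0; last by lra.
  rewrite -mulNr; apply: divr_ge0; last exact: ltW.
  by nra.
Qed.

(* Along an isotropic direction of [q], [f] is affine, hence nondecreasing
   on one of the two half lines; both of them leave the ball [b x x <= s]. *)
Lemma quadratic_raise_to_sphere (R : realType) (V : lmodType R)
    (q b : V -> V -> R) (l : V -> R) (e x : V) (s : R) :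
  symmetric_form q -> scalar l -> definite_form b ->
  e != 0 -> q e e = 0 -> b x x <= s ->
  exists2 y, b y y = s & quadratic q l x <= quadratic q l y.
Proof.
move=> sq ll [sb b_gt0] e0 qe xs.
have [|t [ts tL]] := @quadratic_equation_root R (b e e) (b x e) (b x x - s)
  (q x e *+ 2 + l e) (b_gt0 _ e0); first by lra.
exists (x + t *: e); first by rewrite symmetric_form_line //; lra.
by rewrite quadratic_line // qe mulr0 addr0; lra.
Qed.

(* Any orthogonal direction starts a circle of secant directions
   [h(t) = h0 + t (z2 - z1 - h0)] through [z1]; the second intersections of
   the lines [z1 + R h(t)] with the sphere go from [z1] to [z2]. *)
Lemma quadratic_sphere_ivt (R : realType) (V : lmodType R)
    (q b : V -> V -> R) (l : V -> R) (h0 z1 z2 : V) (s v : R) :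
  symmetric_form q -> scalar l -> definite_form b ->
  h0 != 0 -> b z1 h0 = 0 -> b z1 z1 = s -> b z2 z2 = s ->
  quadratic q l z1 <= v <= quadratic q l z2 ->
  exists2 z, b z z = s & quadratic q l z = v.
Proof.
move=> sq ll [sb b_gt0] h00 bh0 s1 s2 /andP[f1 f2].
have [z12|z12] := eqVneq z1 z2.
  by exists z1 => //; apply/eqP; rewrite eq_le f1 z12 f2.
pose k := z2 - z1 - h0.
have [bD bZ bC] := sb; have [qD qZ qC] := sq.
have ez2 : z2 = z1 + 1 *: (h0 + 1 *: k).
  by rewrite !scale1r /k [h0 + _]addrC subrK [z1 + _]addrC subrK.
have bk : b z1 (h0 + 1 *: k) *+ 2 = - b (h0 + 1 *: k) (h0 + 1 *: k).
  by have := s2; rewrite {1 2}ez2 symmetric_form_line // s1; lra.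
(* This keeps [h0 + t *: k] away from 0: pairing with [z1] gives [t * b z1 k], and at [t = 0] the
   direction is [h0]. *)
have bneg : b z1 k != 0.
  have hn0 : h0 + 1 *: k != 0.
    apply: contra_neq z12 => h; by rewrite ez2 h scaler0 addr0.
  have := b_gt0 _ hn0; have := bk.
  rewrite {1}(symmetric_formDr _ _ _ sb) bh0.
  rewrite (symmetric_formZr _ _ _ sb) => e1 e2.
  by apply/eqP => e3; move: e1; rewrite e3; lra.
pose Bp : {poly R} := (b h0 h0)%:P + (b h0 k *+ 2)%:P * 'X + (b k k)%:P * 'X^2.
pose Qp : {poly R} := (q h0 h0)%:P + (q h0 k *+ 2)%:P * 'X + (q k k)%:P * 'X^2.
pose Lp : {poly R} := (q z1 h0 *+ 2 + l h0)%:P + (q z1 k *+ 2 + l k)%:P * 'X.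
pose bp : {poly R} := (b z1 k *+ 2)%:P * 'X.
(* [P] is [quadratic q l - v] at the second intersection, with the denominator [b h h ^+ 2] cleared,
   so the intermediate value theorem for polynomials applies. *)
pose P : {poly R} := (quadratic q l z1 - v)%:P * Bp ^+ 2 - bp * Lp * Bp
  + bp ^+ 2 * Qp.
have BE t : Bp.[t] = b (h0 + t *: k) (h0 + t *: k).
  rewrite symmetric_form_line // /Bp.
  by rewrite !(hornerD, hornerM, horner_exp, hornerC, hornerX); ring.
have QE t : Qp.[t] = q (h0 + t *: k) (h0 + t *: k).
  rewrite symmetric_form_line // /Qp.
  by rewrite !(hornerD, hornerM, horner_exp, hornerC, hornerX); ring.
have LE t : Lp.[t] = q z1 (h0 + t *: k) *+ 2 + l (h0 + t *: k).
  rewrite (symmetric_formDr _ _ _ sq) (symmetric_formZr _ _ _ sq).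
  rewrite [h0 + _]addrC ll /Lp.
  by rewrite !(hornerD, hornerN, hornerM, horner_exp, hornerC, hornerX); ring.
have bE t : bp.[t] = b z1 (h0 + t *: k) *+ 2.
  rewrite (symmetric_formDr _ _ _ sb) (symmetric_formZr _ _ _ sb) bh0 /bp.
  by rewrite !(hornerD, hornerN, hornerM, horner_exp, hornerC, hornerX); ring.
have PE t : P.[t] = (quadratic q l z1 - v) * Bp.[t] ^+ 2
    - bp.[t] * Lp.[t] * Bp.[t] + bp.[t] ^+ 2 * Qp.[t].
  by rewrite /P !(hornerD, hornerN, hornerM, horner_exp, hornerC, hornerX).
(* The direction [h0] at [t = 0] is tangent, so the second intersection is [z1]; at [t = 1] it is
   [z2]. *)
have [|t _ /rootP Pt] := @poly_ivt R P 0 1 ler01.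
  apply/andP; split.
    rewrite PE bE scale0r addr0 bh0 mul0rn.
    have : 0 <= Bp.[0] ^+ 2 by exact: sqr_ge0.
    by move: f1; nra.
  rewrite PE bE BE bk LE QE.
  move: f2; rewrite {1}ez2 quadratic_line //.
  set B := b (h0 + _) _; set Q := q (h0 + _) _; set L := _ + l _.
  have : 0 <= B ^+ 2 by exact: sqr_ge0.
  by nra.
pose h := h0 + t *: k.
have bh : b z1 h = t * b z1 k.
  by rewrite /h (symmetric_formDr _ _ _ sb) (symmetric_formZr _ _ _ sb)
    bh0 add0r.
have hn0 : h != 0.
  apply/eqP => h_eq0; move: bh.
  rewrite h_eq0 bC symmetric_form0 // => /esym/eqP.
  rewrite mulf_eq0 (negbTE bneg) orbF => /eqP t0.
  by move: h_eq0; rewrite /h t0 scale0r addr0 => /eqP; rewrite (negbTE h00).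
have B0 : b h h != 0 by rewrite gt_eqF // b_gt0.
exists (z1 + (- (b z1 h *+ 2) / b h h) *: h).
  by rewrite symmetric_form_line // s1; field.
rewrite quadratic_line //.
move: Pt; rewrite PE bE BE LE QE -/h => Pt.
apply/eqP; rewrite -subr_eq0; apply/eqP.
apply: (mulfI (expf_neq0 2 B0)); rewrite mulr0 -[RHS]Pt.
by field.
Qed.

(** * Optimality conditions on a sphere *)

Lemma le0_of_le_quadratic (R : realType) (a c d : R) :
  (forall eps, 0 < eps -> a <= eps * c + eps ^+ 2 * d) -> a <= 0.
Proof.
move=> h; apply/ler_addgt0Pr => e e0; rewrite add0r.
pose M := 1 + `|c| + `|d|.
have M0 : 0 < M by rewrite /M ltr_pwDl // ltr_pwDl.
have cM : c <= M by have := ler_norm c; have := normr_ge0 d; rewrite /M; lra.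
have dM : d <= M by have := ler_norm d; have := normr_ge0 c; rewrite /M; lra.
(* This gives [eps <= 1] and [eps * (M *+ 2) < e], so the linear and quadratic terms together stay
   below [e]. *)
pose eps := e / (M *+ 2 + e).
have D0 : 0 < M *+ 2 + e by lra.
have eps0 : 0 < eps by exact: divr_gt0.
have epsE : eps * (M *+ 2 + e) = e by rewrite /eps divfK // gt_eqF.
have eps1 : eps <= 1 by rewrite ler_pdivrMr // mul1r; lra.
have : eps ^+ 2 * d <= eps * M.
  have : eps ^+ 2 * d <= eps ^+ 2 * M by rewrite ler_wpM2l // sqr_ge0.
  have : eps ^+ 2 * M <= eps * M.
    by rewrite ler_wpM2r ?(ltW M0)// expr2 ger_pMl.
  by lra.
have : eps * c <= eps * M by rewrite ler_wpM2l // ltW.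
have := h _ eps0; have : 0 < eps * e by exact: mulr_gt0.
by lra.
Qed.

Lemma symmetric_formN (R : realType) (V : lmodType R) (q : V -> V -> R) :
  symmetric_form q -> symmetric_form (fun x y => - q x y).
Proof.
move=> [qD qZ qC]; split=> *; last by rewrite qC.
- by rewrite qD opprD.
- by rewrite qZ mulrN.
Qed.

Lemma scalarN (R : realType) (V : lmodType R) (l : V -> R) :
  scalar l -> scalar (fun x => - l x).
Proof. by move=> ll c x y; rewrite ll /= opprD mulrN. Qed.

Lemma quadraticN (R : realType) (V : lmodType R) (q : V -> V -> R)
    (l : V -> R) (x : V) :
  quadratic (fun x y => - q x y) (fun x => - l x) x = - quadratic q l x.
Proof. by rewrite /quadratic opprD. Qed.

(** On the plane spanned by two independent vectors the functional [b z] has a nontrivial kernel. *)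
Lemma definite_form_orthogonal (R : realType) (V : lmodType R)
    (b : V -> V -> R) (z : V) : symmetric_form b -> dim_at_least V 3 ->
  exists2 h, h != 0 & b z h = 0.
Proof.
move=> sb [e free_e].
have free2 c d : c *: e ord0 + d *: e (lift ord0 ord0) = 0 -> c = 0 /\ d = 0.
  move=> cd0.
  pose k (i : 'I_3) := if i == ord0 then c else
    if i == lift ord0 ord0 then d else 0.
  have k0 : \sum_(i < 3) k i *: e i = 0.
    by rewrite !big_ord_recl big_ord0 /k /= scale0r !addr0.
  by split; [exact: (free_e k k0 ord0)|exact: (free_e k k0 (lift ord0 ord0))].
have [ze0|ze0] := eqVneq (b z (e ord0)) 0.
  exists (e ord0) => //; apply/eqP => e0.
  have [] := free2 1 0; first by rewrite e0 scaler0 scale0r addr0.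
  by move/eqP; rewrite oner_eq0.
exists (b z (e (lift ord0 ord0)) *: e ord0
        + (- b z (e ord0)) *: e (lift ord0 ord0)).
  by apply/eqP => /free2[_ /eqP]; rewrite oppr_eq0 (negbTE ze0).
rewrite (symmetric_formDr _ _ _ sb) !(symmetric_formZr _ _ _ sb); ring.
Qed.

(* First-order optimality identifies [mu]; the secants through [z] that meet
   the sphere again give [q h h <= mu * b h h], and they are dense. *)
Lemma quadratic_sphere_multiplier (R : realType) (V : lmodType R)
    (q b : V -> V -> R) (l : V -> R) (z : V) (s : R) :
  symmetric_form q -> scalar l -> definite_form b ->
  0 < s -> b z z = s ->
  (forall w, b w w <= s -> quadratic q l w <= quadratic q l z) ->
  exists mu, forall w, quadratic q l w <= quadratic q l z + mu * (b w w - s).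
Proof.
move=> sq ll db s0 zs zmax; have [sb b_gt0] := db.
have [bD bZ bC] := sb.
pose D h := q z h *+ 2 + l h.
have DZ t x y : D (x + t *: y) = D x + t * D y.
  rewrite /D (symmetric_formDr _ _ _ sq) (symmetric_formZr _ _ _ sq).
  by rewrite [x + _]addrC ll; ring.
have DN x : D (- x) = - D x.
  by have := DZ (-1) (- x) (- x); rewrite scaleN1r opprK addNr mulN1r => E;
    have := DZ (-1) x x; rewrite scaleN1r subrr; have := DZ 1 x (- x);
    rewrite scale1r subrr; lra.
(* Such an [h] points into the ball, where a positive derivative [D h] would yield a value above the
   maximum. *)
have D_neg h : b z h < 0 -> D h <= 0.
  move=> zh; rewrite leNgt; apply/negP => Dh.
  pose m := Num.min (- b z h) (D h).
  have m0 : 0 < m by rewrite lt_min oppr_gt0 zh Dh.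
  have mz : m <= - b z h by rewrite /m ge_min lexx.
  have mD : m <= D h by rewrite /m ge_min lexx orbT.
  have bh := definite_form_ge0 h db.
  pose M := 1 + b h h + `|q h h|.
  have M0 : 0 < M by rewrite /M ltr_pwDl // ltr_pwDl.
  (* With this step the second-order terms are dominated by the first-order ones, both in [b] and in
     the quadratic function. *)
  pose t := m / M.
  have t0 : 0 < t by exact: divr_gt0.
  have tM : t * M = m by rewrite /t divfK // gt_eqF.
  have tb : t * b h h <= m.
    by rewrite -tM ler_wpM2l ?(ltW t0)// /M; have := normr_ge0 (q h h); lra.
  have tq : - m < t * q h h.
    rewrite -tM -mulrN ltr_pM2l // /M.
    by have := ler_norm (- q h h); rewrite normrN; lra.
  have := zmax (z + t *: h).
  rewrite symmetric_form_line // quadratic_line // zs -/(D h).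
  have -> : s + t * (b z h *+ 2) + t ^+ 2 * b h h =
    s + t * (b z h *+ 2 + t * b h h) by ring.
  have -> : quadratic q l z + t * D h + t ^+ 2 * q h h =
    quadratic q l z + t * (D h + t * q h h) by ring.
  have H1 : t * (b z h *+ 2 + t * b h h) <= 0 by rewrite pmulr_rle0 //; lra.
  have H2 : 0 < t * (D h + t * q h h) by rewrite pmulr_rgt0 //; lra.
  by lra.
(* A tangent direction is the limit of the inward directions [h - eps *: z]. *)
have D_orth h : b z h = 0 -> D h <= 0.
  move=> zh; apply: (@le0_of_le_quadratic _ _ (D z) 0) => eps eps0.
  have := D_neg (h + (- eps) *: z); rewrite DZ.
  rewrite (symmetric_formDr _ _ _ sb) (symmetric_formZr _ _ _ sb) zh zs.
  have : 0 < eps * s by exact: mulr_gt0.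
  by lra.
have sn0 : s != 0 by rewrite gt_eqF.
pose mu := D z / (s *+ 2).
have D_mu h : D h = mu * (b z h *+ 2).
  have zh' : b z (h + (- (b z h / s)) *: z) = 0.
    rewrite (symmetric_formDr _ _ _ sb) (symmetric_formZr _ _ _ sb) zs.
    by field.
  have zNh' : b z (- (h + (- (b z h / s)) *: z)) = 0.
    by rewrite -scaleN1r (symmetric_formZr _ _ _ sb) zh' mulr0.
  have := D_orth _ zh'; have := D_orth _ zNh'; rewrite DN DZ.
  have -> : mu * (b z h *+ 2) = b z h / s * D z by rewrite /mu; field.
  by lra.
have q_le h : b z h != 0 -> q h h - mu * b h h <= 0.
  move=> zh.
  have h0 : h != 0.
    apply: contra_neq zh => ->; by rewrite bC symmetric_form0.
  have bh0 : b h h != 0 by rewrite gt_eqF // b_gt0.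
  (* The point [z + t *: h] is the second intersection with the sphere, and [D_mu] turns [t * D h]
     into [- mu * t ^+ 2 * b h h]. *)
  pose t := - (b z h *+ 2) / b h h.
  have tb : t * b h h = - (b z h *+ 2) by rewrite /t divfK.
  have t2 : 0 < t ^+ 2.
    rewrite exprn_even_gt0 //= /t mulf_neq0 ?invr_eq0 // oppr_eq0.
    by rewrite mulrn_eq0.
  have := zmax (z + t *: h).
  rewrite symmetric_form_line // quadratic_line // zs -/(D h) D_mu.
  have -> : s + t * (b z h *+ 2) + t ^+ 2 * b h h =
    s + t * (b z h *+ 2 + t * b h h) by ring.
  rewrite tb subrr mulr0 addr0 => /(_ (lexx _)) H1.
  rewrite -(pmulr_rle0 _ t2).
  have -> : t ^+ 2 * (q h h - mu * b h h) =
    t ^+ 2 * q h h - mu * t * (t * b h h) by ring.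
  by rewrite tb; lra.
have q_le_all h : q h h - mu * b h h <= 0.
  have [zh|/q_le//] := eqVneq (b z h) 0.
  apply: (@le0_of_le_quadratic _ _ (- (q h z *+ 2 - mu * (b h z *+ 2)))
    (- (q z z - mu * b z z))) => eps eps0.
  have := q_le (h + eps *: z).
  rewrite (symmetric_formDr _ _ _ sb) (symmetric_formZr _ _ _ sb) zh zs.
  rewrite add0r mulf_neq0 ?gt_eqF // => /(_ isT).
  by rewrite !symmetric_form_line // zs; lra.
exists mu => w.
(* By [D_mu] the first-order terms cancel, leaving [q - mu * b] at [w - z]. *)
have -> : w = z + 1 *: (w - z) by rewrite scale1r addrC subrK.
rewrite symmetric_form_line // quadratic_line // zs -/(D _) D_mu.
by have := q_le_all (w - z); lra.
Qed.

(** * Closedness of the image, extrema on spheres and convexity *)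

(* The values [(f x, b x x)] are closed up to a drop of the second
   coordinate, as is the case under weak limits. *)
Definition weakly_closed_image (R : realType) (V : lmodType R)
    (q b : V -> V -> R) (l : V -> R) :=
  forall u s,
    (forall eps, 0 < eps ->
      exists x, `|quadratic q l x - u| < eps /\ `|b x x - s| < eps) ->
    exists x, quadratic q l x = u /\ b x x <= s.

Lemma weakly_closed_imageN (R : realType) (V : lmodType R)
    (q b : V -> V -> R) (l : V -> R) :
  weakly_closed_image q b l ->
  weakly_closed_image (fun x y => - q x y) b (fun x => - l x).
Proof.
move=> wc u s us; have [|x [xu xs]] := wc (- u) s.
  move=> eps /us[x [xu xs]]; exists x; split => //.
  by move: xu; rewrite quadraticN -opprD normrN opprK.
by exists x; split => //; rewrite quadraticN xu opprK.
Qed.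

(** Moving along [e] for the function and for its negative gives two points of the sphere whose
    values enclose the one at [x]; an intermediate value finishes. *)
Lemma quadratic_ball_sphere (R : realType) (V : lmodType R)
    (q b : V -> V -> R) (l : V -> R) (e x : V) (s : R) :
  symmetric_form q -> scalar l -> definite_form b -> dim_at_least V 3 ->
  e != 0 -> q e e = 0 -> b x x <= s ->
  exists2 y, b y y = s & quadratic q l y = quadratic q l x.
Proof.
move=> sq ll db dimV e0 qe xs.
have [z2 z2s z2x] := quadratic_raise_to_sphere sq ll db e0 qe xs.
have [|||z1 z1s] :=
    @quadratic_raise_to_sphere R V (fun x y => - q x y) b (fun x => - l x)
      e x s _ _ db e0 _ xs.
- exact: symmetric_formN.
- exact: scalarN.
- by rewrite qe oppr0.
rewrite !quadraticN lerN2 => z1x.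
have [h0 h00 zh0] := definite_form_orthogonal z1 db.1 dimV.
by apply: (quadratic_sphere_ivt sq ll db h00 zh0 z1s z2s); rewrite z1x z2x.
Qed.

Lemma quadratic_image_closed (R : realType) (V : lmodType R)
    (q b : V -> V -> R) (l : V -> R) (e : V) (u s : R) :
  symmetric_form q -> scalar l -> definite_form b -> dim_at_least V 3 ->
  e != 0 -> q e e = 0 -> weakly_closed_image q b l ->
  (forall eps, 0 < eps ->
    exists x, `|quadratic q l x - u| < eps /\ `|b x x - s| < eps) ->
  exists2 x, quadratic q l x = u & b x x = s.
Proof.
move=> sq ll db dimV e0 qe wc /wc[x [<- xs]].
have [y ys yx] := quadratic_ball_sphere sq ll db dimV e0 qe xs.
by exists y.
Qed.

(** The supremum over the sphere is a limit of values at the fixed level [s], so closedness of the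
    image attains it; the ball has no values beyond those of the sphere. *)
Lemma quadratic_ball_max (R : realType) (V : lmodType R)
    (q b : V -> V -> R) (l : V -> R) (e : V) (s M : R) :
  symmetric_form q -> scalar l -> definite_form b -> dim_at_least V 3 ->
  e != 0 -> q e e = 0 -> weakly_closed_image q b l ->
  0 <= s -> (forall x, b x x = s -> quadratic q l x <= M) ->
  exists2 z, b z z = s &
    forall w, b w w <= s -> quadratic q l w <= quadratic q l z.
Proof.
move=> sq ll db dimV e0 qe wc s0 fM.
pose E := [set quadratic q l x | x in [set x | b x x = s]].
have supE : has_sup E.
  split; last by exists M => _ [x xs <-]; exact: fM.
  have [|y ys _] := @quadratic_ball_sphere R V q b l e 0 s sq ll db dimV e0 qe.
    by rewrite symmetric_form0 //; case: db.
  by exists (quadratic q l y), y.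
have [|z zE zs] := @quadratic_image_closed R V q b l e (sup E) s
    sq ll db dimV e0 qe wc.
  move=> eps eps0; have [_ [x xs <-] xE] := sup_adherent eps0 supE.
  exists x; rewrite xs subrr normr0; split => //.
  have : quadratic q l x <= sup E by apply: (ub_le_sup supE.2); exists x.
  by rewrite ltr_norml; lra.
exists z => // w ws; rewrite zE.
have [y ys <-] := quadratic_ball_sphere sq ll db dimV e0 qe ws.
by apply: (ub_le_sup supE.2); exists y.
Qed.

Lemma quadratic_image_convex (R : realType) (V : lmodType R)
    (q b : V -> V -> R) (l : V -> R) (e x y : V) (k : R) :
  symmetric_form q -> scalar l -> definite_form b -> dim_at_least V 3 ->
  e != 0 -> q e e = 0 -> weakly_closed_image q b l ->
  (forall s, exists M, forall x, b x x = s -> `|quadratic q l x| <= M) ->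
  0 < k < 1 ->
  exists2 z, quadratic q l z = k * quadratic q l x + (1 - k) * quadratic q l y
    & b z z = k * b x x + (1 - k) * b y y.
Proof.
move=> sq ll db dimV e0 qe wc bnd /andP[k0 k1].
have x0 := definite_form_ge0 x db; have y0 := definite_form_ge0 y db.
set s := k * b x x + _; set u := k * quadratic _ _ _ + _.
have k1' : 0 < 1 - k by lra.
have kx : 0 <= k * b x x by apply: mulr_ge0 => //; exact: ltW.
have ky : 0 <= (1 - k) * b y y by apply: mulr_ge0 => //; exact: ltW.
have s0 : 0 <= s by rewrite /s; lra.
(* At level 0 definiteness forces [x = y = 0]; multipliers need [0 < s]. *)
have [sz|s_neq0] := eqVneq s 0.
  have zero z : b z z = 0 -> z = 0.
    move=> z0; apply/eqP; apply/negPn/negP => /(db.2); by rewrite z0 ltxx.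
  have ex : x = 0.
    apply: zero; apply/eqP; rewrite -(mulrI_eq0 _ (lregP (lt0r_neq0 k0))).
    by apply/eqP; move: sz; rewrite /s; lra.
  have ey : y = 0.
    apply: zero; apply/eqP; rewrite -(mulrI_eq0 _ (lregP (lt0r_neq0 k1'))).
    by apply/eqP; move: sz; rewrite /s; lra.
  rewrite /u /s ex ey; exists 0; first by ring.
  by rewrite symmetric_form0 ?mulr0 ?addr0 //; case: db.
have {}s_gt0 : 0 < s by rewrite lt_neqAle eq_sym s_neq0.
have [M fM] := bnd s.
have [|z2 z2s z2max] := @quadratic_ball_max R V q b l e s M
    sq ll db dimV e0 qe wc s0.
  by move=> w /fM; apply: le_trans; exact: ler_norm.
have [||z1 z1s z1max] := @quadratic_ball_max R V (fun x y => - q x y) b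
    (fun x => - l x) e s M (symmetric_formN sq) (scalarN ll) db dimV e0 _
    (weakly_closed_imageN wc) s0.
- by rewrite qe oppr0.
- by move=> w /fM; apply: le_trans; rewrite quadraticN -normrN; exact: ler_norm.
have [m2 H2] := quadratic_sphere_multiplier sq ll db s_gt0 z2s z2max.
have [m1 H1] := quadratic_sphere_multiplier (symmetric_formN sq) (scalarN ll)
  db s_gt0 z1s z1max.
have [h0 h00 zh0] := definite_form_orthogonal z1 db.1 dimV.
(* The multiplier terms cancel because [s] is the averaged level, which puts [u] between the
   extrema. *)
have avg (m : R) : k * (m * (b x x - s)) + (1 - k) * (m * (b y y - s)) = 0.
  by rewrite /s; ring.
have [|z zs zu] := @quadratic_sphere_ivt R V q b l h0 z1 z2 s u
    sq ll db h00 zh0 z1s z2s.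
  apply/andP; split.
  - have := ler_wpM2l (ltW k0) (H1 x); have := ler_wpM2l (ltW k1') (H1 y).
    by rewrite !quadraticN; have := avg m1; rewrite /u; lra.
  - have := ler_wpM2l (ltW k0) (H2 x); have := ler_wpM2l (ltW k1') (H2 y).
    by have := avg m2; rewrite /u; lra.
by exists z.
Qed.

(** * Inner products and the Riesz representation *)

Lemma dot_symmetric_form (R : realType) (H : lmodType R)
    (ip : {dot H for idfun}) : symmetric_form (ip : H -> H -> R).
Proof.
split=> [x y z|c x y|x y]; first exact: linearDl.
- exact: linearZl_LR.
- by rewrite hermC expr0 mul1r.
Qed.

Lemma dot_definite_form (R : realType) (H : completeNormedModType R)
    (ip : {dot H for idfun}) : induces_norm ip ->
  definite_form (ip : H -> H -> R).
Proof.
move=> hip; split; first exact: dot_symmetric_form.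
by move=> x x0; rewrite -hip exprn_gt0 // normr_gt0.
Qed.

Lemma dot_norm_le (R : realType) (H : completeNormedModType R)
    (ip : {dot H for idfun}) (x y : H) : induces_norm ip ->
  `|ip x y| <= `|x| * `|y|.
Proof.
move=> hip; rewrite -(@ler_pXn2r _ 2) ?nnegrE ?mulr_ge0 //.
rewrite real_normK ?num_real // exprMn !hip.
exact: definite_form_CauchySchwarz (dot_definite_form hip).
Qed.

(** The representing vector minimises [J x = |x|^2 - 2 l x]; completeness of [H] provides the
    minimiser. *)
Lemma riesz_representation (R : realType) (H : completeNormedModType R)
    (ip : {dot H for idfun}) (l : H -> R) (C : R) : induces_norm ip ->
  scalar l -> (forall x, `|l x| <= C * `|x|) ->
  exists z, forall x, ip z x = l x.
Proof.
move=> hip ll lC.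
have sip := dot_symmetric_form ip.
have [C0|C0] := leP 0 C; last first.
  have zero x : l x = 0.
    apply/eqP; rewrite -normr_le0; apply: le_trans (lC x) _.
    by rewrite nmulr_rle0.
  by exists 0 => x; rewrite (symmetric_form0 _ sip) zero.
pose l2 x := - (l x *+ 2).
have ll2 : scalar l2 by move=> c x y; rewrite /l2 ll /=; ring.
pose J := quadratic (ip : H -> H -> R) l2.
have JE x : J x = `|x| ^+ 2 - l x *+ 2 by rewrite /J /quadratic hip.
have JL x h t : J (x + t *: h) =
    J x + t * ((ip x h - l h) *+ 2) + t ^+ 2 * `|h| ^+ 2.
  by rewrite /J quadratic_line // hip /l2; ring.
have infJ : has_inf (range J).
  split; first by exists (J 0), 0.
  exists (- C ^+ 2) => _ [x _ <-]; rewrite JE.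
  by have := lC x; have := ler_norm (l x); have := sqr_ge0 (`|x| - C); nra.
pose m := inf (range J).
have mJ x : m <= J x by apply: ge_inf; [exact: infJ.2|exists x].
pose D (e : R) := [set x | J x < m + e].
have FP : ProperFilter (filter_from [set e : R | 0 < e] D).
  apply: filter_from_proper; last first.
    by move=> e /= e0; have [_ [x _ <-] ?] := inf_adherent e0 infJ; exists x.
  apply: filter_from_filter; first by exists 1; exact: ltr01.
  move=> e e' /= e0 e0'; exists (Num.min e e'); first by rewrite /= lt_min e0.
  move=> x; rewrite /D /= => xe; split; apply: (lt_le_trans xe);
    by rewrite lerD2l ge_min lexx ?orbT.
have /cauchy_cvgP : cauchy (filter_from [set e : R | 0 < e] D).
  apply: cauchy_exP => e e0.
  (* Points with values within [e ^+ 2 / 4] of the infimum are less than [e] apart, since [J] at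
     their midpoint is at least [m]. *)
  have e2 : 0 < e ^+ 2 / 4 by rewrite divr_gt0 ?exprn_gt0.
  have [_ [x _ <-] xe] := inf_adherent e2 infJ; rewrite -/m in xe.
  exists x, (e ^+ 2 / 4) => //= y; rewrite /D /= => ye.
  rewrite -ball_normE /= -(@ltr_pXn2r _ 2) ?nnegrE ?(ltW e0) //.
  have xE : x = y + 1 *: (x - y) by rewrite scale1r addrC subrK.
  have := JL y (x - y) 1; rewrite -xE => J1.
  have := mJ (y + 2^-1 *: (x - y)); rewrite JL => J2.
  by move: J1 J2 xe ye; set d := ip y _ - _; set n := `|_| ^+ 2; lra.
move=> /cvg_ex[z zlim]; exists z.
(* Continuity of [J] at [z]: compare with a point [y] within [e] of [z] and with [J y < m + e]. *)
have Jz : J z <= m.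
  rewrite -subr_le0.
  apply: (@le0_of_le_quadratic _ _ (1 + (`|z| + C) *+ 2) 0) => e e0.
  have [y [yz yD]] : exists y, ball z e y /\ D e y.
    have : filter_from [set e : R | 0 < e] D (ball z e `&` D e).
      apply: filterI; last by exists e.
      by apply: zlim; exact: nbhsx_ballx.
    by move=> /filter_ex[y [? ?]]; exists y.
  rewrite -ball_normE /= in yz; rewrite /D /= in yD.
  have yE : y = z + 1 *: (y - z) by rewrite scale1r addrC subrK.
  have := JL z (y - z) 1; rewrite -yE distrC in yz * => Jy.
  have n0 := sqr_ge0 `|y - z|.
  have i1 := dot_norm_le z (y - z) hip.
  have i2 := lC (y - z).
  have i3 : `|z| * `|y - z| <= `|z| * e by rewrite ler_wpM2l // ltW.
  have i4 : C * `|y - z| <= C * e by rewrite ler_wpM2l // ltW.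
  have := ler_norm (- ip z (y - z)); rewrite normrN => i5.
  have := ler_norm (l (y - z)) => i6.
  by rewrite mulr0 addr0; lra.
(* Minimality at [z + e *: h], divided by [e]; the directions [x] and [- x] together give
   equality. *)
have half h : l h - ip z h <= 0.
  apply: (@le0_of_le_quadratic _ _ (`|h| ^+ 2 / 2) 0) => e e0.
  have : m <= J (z + e *: h) by exact: mJ.
  rewrite JL mulr0 addr0 => H1.
  rewrite -subr_ge0 -(pmulr_rge0 _ e0).
  by move: H1; set n := `|h| ^+ 2; lra.
move=> x; have := half x; have := half (- x).
rewrite -scaleN1r (symmetric_formZr _ _ _ sip).
have := ll (-1) x 0; rewrite addr0 => ->.
have := ll (-1) 0 0; rewrite scaler0 addr0 => l0.
by move=> h1 h2; apply/eqP; rewrite eq_le; apply/andP; split; lra.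
Qed.

(** * Weak limits along ultrafilters *)

Lemma ultra_fmap (T U : Type) (f : T -> U) (G : set_system T) :
  UltraFilter G -> UltraFilter (f @ G).
Proof.
move=> GU; split; first exact: fmap_proper_filter.
move=> K KP GK; apply/seteqP; split => // A KA.
have [//|GnA] := in_ultra_setVsetC (f @^-1` A) GU.
have : K (~` A) by apply: GK.
by move=> /(filterI KA); rewrite setICr => /filter_not_empty.
Qed.

(** Weak compactness of balls: each [ip x y] stays in a compact segment, hence converges along [G],
    and the limits form a bounded functional of [y]. *)
Lemma bounded_ultra_weak_cvg (R : realType) (H : completeNormedModType R)
    (ip : {dot H for idfun}) (G : set_system H) (C : R) : induces_norm ip ->
  UltraFilter G -> G [set x | `|x| <= C] ->
  exists z, forall y, ip x y @[x --> G] --> ip z y.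
Proof.
move=> hip GU GC.
have sip := dot_symmetric_form ip.
have lim_ex y : exists u : R, `|u| <= C * `|y| /\ ip x y @[x --> G] --> u.
  have := @segment_compact R (- (C * `|y|)) (C * `|y|).
  rewrite compact_ultra => /(_ _ (ultra_fmap (ip ^~ y) GU)) [].
    apply: (@filterS _ G _ _ _ _ GC) => x /= xC; rewrite in_itv /= -ler_norml.
    by apply: (le_trans (dot_norm_le x y hip)); rewrite ler_wpM2r.
  by move=> u [/=]; rewrite in_itv /= -ler_norml => uC ulim; exists u.
have /choice[l lP] := lim_ex.
have ll : scalar l.
  move=> c x y; apply: (@cvg_unique _ _ (ip ^~ (c *: x + y) @ G)) => //.
  - exact: (lP _).2.
  - have -> : ip ^~ (c *: x + y) = (fun w => c * ip w x + ip w y).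
      apply/funext => w.
      by rewrite (symmetric_formDr _ _ _ sip) (symmetric_formZr _ _ _ sip).
    apply: cvgD; last exact: (lP _).2.
    by apply: cvgMr; exact: (lP _).2.
have [z zl] := riesz_representation hip ll (fun y => (lP y).1).
by exists z => y; rewrite zl; exact: (lP _).2.
Qed.

(** Compactness makes [A x] converge in norm when [x] converges weakly, while the form of [B] is
    only weakly lower semicontinuous. *)
Lemma compact_operator_weakly_closed_image (R : realType)
    (H : completeNormedModType R) (ip : {dot H for idfun}) (A B : H -> H)
    (a : H) (M : R) : induces_norm ip ->
  compact_operator A -> symmetric_operator ip A ->
  definite_form (fun x y => ip (B x) y) ->
  (forall x, `|x| ^+ 2 <= M * ip (B x) x) ->
  weakly_closed_image (fun x y => ip (A x) y) (fun x y => ip (B x) y)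
    (ip ^~ a).
Proof.
move=> hip [_ cptA] sA dB coercB u s us.
have sip := dot_symmetric_form ip; have [_ _ ipC] := sip.
set f := quadratic _ _ in us *.
pose g x := ip (B x) x.
pose D (e : R) := [set x | `|f x - u| < e /\ `|g x - s| < e].
have FP : ProperFilter (filter_from [set e : R | 0 < e] D).
  apply: filter_from_proper; last by move=> e /us[x xe]; exists x.
  apply: filter_from_filter; first by exists 1; exact: ltr01.
  move=> e e' /= e0 e0'; exists (Num.min e e'); first by rewrite /= lt_min e0.
  by move=> x [/= ]; rewrite !lt_min => /andP[? ?] /andP[? ?].
have [G [GU FG]] := ultraFilterLemma FP.
have GD e : 0 < e -> G (D e) by move=> e0; apply: FG; exists e.
have f_lim : f x @[x --> G] --> u.
  apply/cvgrPdist_lt => e /GD; apply: filterS => x [+ _].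
  by rewrite distrC.
have g_lim : g x @[x --> G] --> s.
  apply/cvgrPdist_lt => e /GD; apply: filterS => x [_ +].
  by rewrite distrC.
(* On [D 1] coercivity bounds [|x|^2] by [C - 1], and [|x| <= |x|^2 + 1/4]. *)
pose C := 1 + `|M| * (`|s| + 1).
have C0 : 0 < C by rewrite ltr_pwDl // mulr_ge0 // addr_ge0.
have GC : G [set x | `|x| <= C].
  apply: (@filterS _ G _ _ _ _ (GD 1 ltr01)) => x [_] /=.
  have g0 : 0 <= g x by exact: (definite_form_ge0 x dB).
  rewrite ltr_norml => /andP[_ gs].
  have gS : g x <= `|s| + 1 by have := ler_norm s; lra.
  have x2 : `|x| ^+ 2 <= `|M| * (`|s| + 1).
    apply: (le_trans (coercB x)); apply: (@le_trans _ _ (`|M| * g x)).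
      by rewrite ler_wpM2r // ler_norm.
    by rewrite ler_wpM2l.
  by rewrite /C; have := sqr_ge0 (`|x| - 2^-1); lra.
have [z z_lim] := bounded_ultra_weak_cvg hip GU GC.
have [v v_lim] : exists v : H, A x @[x --> G] --> v.
  have bddC : bounded_set [set x : H | `|x| <= C].
    exists C; split=> [|r Cr x /= /le_trans]; first exact: num_real.
    by apply; exact: ltW.
  have := cptA _ bddC; rewrite precompactE compact_ultra.
  move=> /(_ _ (ultra_fmap A GU)) [|v [_ vlim]]; last by exists v.
  apply: (@filterS _ G _ _ _ _ GC) => x xC.
  by apply: subset_closure; exists x.
have dot_lim (F : H -> H) w y : F x @[x --> G] --> w ->
    ip (F x) y @[x --> G] --> ip w y.
  move=> Fw; apply/cvgrPdist_lt => e e0.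
  have e1 : 0 < e / (1 + `|y|) by rewrite divr_gt0 // ltr_pwDl.
  move/cvgrPdist_lt: Fw => /(_ _ e1); apply: filterS => x wF.
  rewrite -linearBl; apply: (le_lt_trans (dot_norm_le _ _ hip)).
  move: wF; rewrite ltr_pdivlMr ?ltr_pwDl //.
  by apply: le_lt_trans; rewrite ler_wpM2l // lerDr.
have A_weak y : ip (A x) y @[x --> G] --> ip (A z) y.
  rewrite sA; under eq_fun do rewrite sA.
  exact: z_lim.
(* The norm limit and the weak limit agree when tested against their difference. *)
have vE : v = A z.
  apply/eqP; rewrite -subr_eq0 -normr_eq0 -sqrf_eq0 hip linearBl subr_eq0.
  apply/eqP; apply: (@cvg_unique _ _ (ip (A x) (v - A z) @[x --> G])) => //.
    exact: dot_lim.
  exact: A_weak.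
exists z; split.
- apply: (@cvg_unique _ _ (f x @[x --> G])) => //.
  have -> : f z = 0 + ip z v + ip z a.
    by rewrite add0r /f /quadratic vE sA.
  have -> : f = fun x => ip (A x - v) x + ip x v + ip x a.
    apply/funext => x; rewrite /f /quadratic linearBl.
    by rewrite [ip x v]ipC subrK.
  apply: cvgD; last exact: z_lim.
  apply: cvgD; last exact: z_lim.
  apply/cvgrPdist_lt => e e0.
  have e1 : 0 < e / C by rewrite divr_gt0.
  move/cvgrPdist_lt: v_lim => /(_ _ e1) vA.
  apply: filterS2 vA GC => x xv /= xC.
  rewrite sub0r normrN; apply: (le_lt_trans (dot_norm_le _ _ hip)).
  apply: (@le_lt_trans _ _ (`|A x - v| * C)); first by rewrite ler_wpM2l.
  by rewrite -ltr_pdivlMr // distrC.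
- have [[_ _ BC] _] := dB.
  have lim2 : ip x (B z) *+ 2 - ip (B z) z @[x --> G]
      --> ip z (B z) *+ 2 - ip (B z) z.
    by apply: cvgB; [apply: cvgMn; exact: z_lim|exact: cvg_cst].
  have -> : ip (B z) z = ip z (B z) *+ 2 - ip (B z) z.
    by rewrite ipC; ring.
  apply: (ler_cvg_to lim2 g_lim); near=> x.
  have := definite_form_ge0 (x + (-1) *: z) dB.
  rewrite (symmetric_form_line _ _ _ dB.1) -/(g x).
  by rewrite (BC x z) [ip x _]ipC; lra.
Unshelve. all: by end_near.
Qed.

Lemma symmetric_operator_form (R : realType) (H : lmodType R)
    (ip : {dot H for idfun}) (A : H -> H) : linear A ->
  symmetric_operator ip A -> symmetric_form (fun x y => ip (A x) y).
Proof.
have [ipD ipZ ipC] := dot_symmetric_form ip => lA sA.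
split=> [x y z|c x y|x y]; last by rewrite sA ipC.
- by have := lA 1 x y; rewrite !scale1r => ->; rewrite ipD.
- have A0 : A 0 = 0.
    have := lA 1 0 0; rewrite !scale1r addr0 => /eqP.
    by rewrite -subr_eq0 opprD addNKr oppr_eq0 => /eqP.
  by have := lA c x 0; rewrite !addr0 A0 addr0 => ->; rewrite ipZ.
Qed.

Lemma GL_plus_definite_form (R : realType) (H : completeNormedModType R)
    (ip : {dot H for idfun}) (B : H -> H) : GL_plus ip B ->
  definite_form (fun x y => ip (B x) y).
Proof.
by move=> [[lB _] _ sB B_gt0]; split => //; exact: symmetric_operator_form.
Qed.

Lemma GL_plus_coercive (R : realType) (H : completeNormedModType R)
    (ip : {dot H for idfun}) (B : H -> H) : induces_norm ip ->
  GL_plus ip B -> exists M, forall x, `|x| ^+ 2 <= M * ip (B x) x.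
Proof.
move=> hip BG; have dB := GL_plus_definite_form BG.
have [_ [S [[_ [M SM]] BS SB]] _ _] := BG.
exists M => x; have [->|x0] := eqVneq x 0.
  by rewrite normr0 expr0n /= (symmetric_form0 _ dB.1) mulr0.
have x2 : 0 < `|x| ^+ 2 by rewrite exprn_gt0 // normr_gt0.
have := definite_form_CauchySchwarz (S x) x dB; rewrite /= SB -hip => CS.
have Bx := definite_form_ge0 x dB.
have : ip x (S x) <= M * `|x| ^+ 2.
  apply: (le_trans (ler_norm _)); apply: (le_trans (dot_norm_le _ _ hip)).
  by rewrite [_ ^+ 2]expr2 mulrCA ler_wpM2l.
move=> /(ler_wpM2r Bx) => H1; rewrite -(ler_pM2l x2).
move: (le_trans CS H1); rewrite expr2.
by set n := `|x| ^+ 2; set m := ip (B x) x; lra.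
Qed.

Lemma bounded_operator_quadratic_bounded (R : realType)
    (H : completeNormedModType R) (ip : {dot H for idfun}) (A : H -> H)
    (a : H) (r : R) : induces_norm ip -> bounded_operator A ->
  exists N, forall x, `|x| ^+ 2 <= r ->
    `|quadratic (fun x y => ip (A x) y) (ip ^~ a) x| <= N.
Proof.
move=> hip [_ [M AM]].
exists (`|M| * r + (1 + r) * `|a|) => x xr; rewrite /quadratic.
apply: (le_trans (ler_normD _ _)); apply: lerD.
  apply: (le_trans (dot_norm_le _ _ hip)).
  apply: (@le_trans _ _ (M * `|x| ^+ 2)).
    by rewrite expr2 mulrA ler_wpM2r.
  apply: (@le_trans _ _ (`|M| * `|x| ^+ 2)).
    by rewrite ler_wpM2r ?sqr_ge0 // ler_norm.
  by rewrite ler_wpM2l.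
apply: (le_trans (dot_norm_le _ _ hip)); rewrite ler_wpM2r //.
by have := sqr_ge0 (`|x| - 2^-1); lra.
Qed.

Theorem proposition3p3 (R : realType) (H : completeNormedModType R)
    (ip : {dot H for idfun}) (hip : induces_norm ip)
    (hdim : dim_at_least H 3)
    (A1 A2 : H -> H)
    (hA1 : bounded_operator A1) (hA1s : symmetric_operator ip A1)
    (hA2 : bounded_operator A2) (hA2s : symmetric_operator ip A2)
    (a1 a2 : H) (b1 b2 : R) :
  let phi1 := quadratic_function ip A1 a1 b1 in
  let phi2 := quadratic_function ip A2 a2 b2 in
  let Phi : H -> R^o * R^o := fun x => (phi1 x, phi2 x) in
  (exists alpha1 alpha2 beta1 beta2 : R,
     let tA1 : H -> H := fun x => alpha1 *: A1 x + alpha2 *: A2 x in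
     let tA2 : H -> H := fun x => beta1 *: A1 x + beta2 *: A2 x in
     [/\ alpha1 * beta2 - alpha2 * beta1 != 0,
         compact_operator tA1,
         exists x : H, x != 0 /\ ip (tA1 x) x = 0 &
         GL_plus ip tA2]) ->
  convex_set (range Phi : set (convex_lmodType (R^o * R^o)%type)) /\
  closed (range Phi).
Proof.
move=> phi1 phi2 Phi [al1 [al2 [be1 [be2 [det0 cptA [e [e0 Ae]] BG]]]]].
set A := (fun x => al1 *: A1 x + al2 *: A2 x) in cptA Ae.
set B := (fun x => be1 *: A1 x + be2 *: A2 x) in BG.
have sip := dot_symmetric_form ip; have [ipD ipZ ipC] := sip.
have ipDr := symmetric_formDr _ _ _ sip.
have ipZr := symmetric_formZr _ _ _ sip.
have sA : symmetric_operator ip A.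
  by move=> x y; rewrite /A ipD !ipZ hA1s hA2s ipDr !ipZr.
have sqA := symmetric_operator_form cptA.1 sA.
have bA : bounded_operator A.
  have [lA _] := cptA; split => //.
  have [[_ [M1 hM1]] [_ [M2 hM2]]] := (hA1, hA2).
  exists (`|al1| * M1 + `|al2| * M2) => x.
  apply: (le_trans (ler_normD _ _)); rewrite !normrZ mulrDl -!mulrA.
  by apply: lerD; rewrite ler_wpM2l.
have dB := GL_plus_definite_form BG.
have [M coercB] := GL_plus_coercive hip BG.
have [_ [S [_ BS SB]] sB _] := BG.
pose c := be1 *: a1 + be2 *: a2.
pose x1 := S (2^-1 *: c).
have Bx1 : B x1 = 2^-1 *: c by rewrite /x1 SB.
pose a := al1 *: a1 + al2 *: a2 + (- 2) *: A x1.
have scalar_a : scalar (ip ^~ a) by move=> k x y; rewrite ipD ipZ.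
pose f := quadratic (fun x y => ip (A x) y) (ip ^~ a).
pose g x := ip (B x) x.
have wc := compact_operator_weakly_closed_image hip cptA sA dB coercB (a := a).
have phiE (k1 k2 : R) x : k1 * phi1 x + k2 * phi2 x =
    ip (k1 *: A1 x + k2 *: A2 x) x + ip x (k1 *: a1 + k2 *: a2)
    + (k1 * b1 + k2 * b2).
  rewrite /phi1 /phi2 /quadratic_function ipD !ipZ ipDr !ipZr; ring.
pose k1 := ip (A x1) x1 - ip x1 (al1 *: a1 + al2 *: a2) + (al1 * b1 + al2 * b2).
pose k2 := - ip (B x1) x1 + (be1 * b1 + be2 * b2).
have fE y : al1 * phi1 (y + (-1) *: x1) + al2 * phi2 (y + (-1) *: x1) =
    f y + k1.
  rewrite phiE -/(A _) (symmetric_form_line _ _ _ sqA) /f /quadratic /a /k1.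
  rewrite (sA y x1) [ip y (_ + _ *: A x1)]ipDr ipZr.
  rewrite [ip (_ + _ *: x1) _]ipD ipZ; ring.
have gE y : be1 * phi1 (y + (-1) *: x1) + be2 * phi2 (y + (-1) *: x1) =
    g y + k2.
  rewrite phiE -/(B _) -/c (symmetric_form_line _ _ _ dB.1) /g /k2.
  rewrite (sB y x1) Bx1 [ip (_ + _ *: x1) _]ipD [ip (-1 *: x1) _]ipZ.
  rewrite [ip (_ *: c) _]ipZ [ip _ (_ *: c)]ipZr [ip c _]ipC; lra.
have rangeE p : range Phi p <-> exists2 y,
    f y = al1 * p.1 + al2 * p.2 - k1 & g y = be1 * p.1 + be2 * p.2 - k2.
  split; first move=> [x _ <-].
    have xE : x + x1 + (-1) *: x1 = x by rewrite scaleN1r addrK.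
    have := gE (x + x1); have := fE (x + x1); rewrite xE => E1 E2.
    by exists (x + x1); [rewrite /= E1 addrK|rewrite /= E2 addrK].
  move=> [y fy gy]; exists (y + (-1) *: x1) => //.
  have := fE y; have := gE y; rewrite fy gy !subrK => E2 E1.
  case: p {fy gy} E1 E2 => p1 p2 /= E1 E2.
  congr pair; apply: (mulfI det0).
    set q1 := phi1 _ in E1 E2 *; set q2 := phi2 _ in E1 E2 *.
    have -> : (al1 * be2 - al2 * be1) * q1 =
      be2 * (al1 * q1 + al2 * q2) - al2 * (be1 * q1 + be2 * q2) by ring.
    by rewrite E1 E2; ring.
  set q1 := phi1 _ in E1 E2 *; set q2 := phi2 _ in E1 E2 *.
  have -> : (al1 * be2 - al2 * be1) * q2 =
    al1 * (be1 * q1 + be2 * q2) - be1 * (al1 * q1 + al2 * q2) by ring.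
  by rewrite E1 E2; ring.
split.
- apply/convex_setW => p q /set_mem/rangeE[x fx gx] /set_mem/rangeE[y fy gy].
  move=> k k0 k_lt1.
  have bnd s : exists N, forall x, ip (B x) x = s ->
      `|quadratic (fun x y => ip (A x) y) (ip ^~ a) x| <= N.
    have [N fN] := bounded_operator_quadratic_bounded a (M * s) hip bA.
    by exists N => w ws; apply: fN; rewrite -ws.
  have [|z fz gz] := quadratic_image_convex x y (k := k%:num) sqA scalar_a dB
    hdim e0 Ae wc bnd.
    by rewrite k0.
  apply/mem_set/rangeE; exists z.
    rewrite [f z]fz -/(f x) -/(f y) fx fy /= /unstable.onem.
    by rewrite -![_ *: _]/(_ * _); ring.
  rewrite [g z]gz -/(g x) -/(g y) gx gy /= /unstable.onem.
  by rewrite -![_ *: _]/(_ * _); ring.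
- rewrite closure_id; apply/seteqP; split; first exact: subset_closure.
  move=> p cl_p; apply/rangeE.
  apply: (quadratic_image_closed sqA scalar_a dB hdim e0 Ae wc) => eps eps0.
  pose K := 1 + `|al1| + `|al2| + `|be1| + `|be2|.
  have K0 : 0 < K by rewrite /K !ltr_pwDl.
  pose d := eps / K.
  have d0 : 0 < d by exact: divr_gt0.
  have dK : d * K = eps by rewrite /d divfK // gt_eqF.
  have [q [/rangeE[y fy gy] [q1 q2]]] := cl_p _ (nbhsx_ballx p d d0).
  exists y; rewrite -/(f y) -/(g y) fy gy.
  move: q1 q2; rewrite -!ball_normE /= => q1 q2.
  have bound (u v : R) : `|u| + `|v| < K ->
      `|u * q.1 + v * q.2 - (u * p.1 + v * p.2)| < eps.
    move=> uv.
    have -> : u * q.1 + v * q.2 - (u * p.1 + v * p.2) =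
      - (u * (p.1 - q.1) + v * (p.2 - q.2)) by ring.
    rewrite normrN; apply: (le_lt_trans (ler_normD _ _)); rewrite !normrM.
    have i1 : `|u| * `|p.1 - q.1| <= `|u| * d by rewrite ler_wpM2l // ltW.
    have i2 : `|v| * `|p.2 - q.2| <= `|v| * d by rewrite ler_wpM2l // ltW.
    have i3 : d * (`|u| + `|v|) < d * K by rewrite ltr_pM2l.
    by lra.
  have n1 := normr_ge0 al1; have n2 := normr_ge0 al2.
  have n3 := normr_ge0 be1; have n4 := normr_ge0 be2.
  have cancel_k (u v k : R) : u - k - (v - k) = u - v by ring.
  by split; rewrite cancel_k; apply: bound; rewrite /K; lra.
Qed.
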